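(* Let $(M_1\times_f M_2,F)$ be a flat twisted product Finsler manifold and suppose $(M_1,F_1)$ is Riemannian. If $f$ is a function on $M_2$ only, then $(M_1,F_1)$ is locally flat.
   Context: Let $(M_1,F_1)$, $(M_2,F_2)$ be Finsler manifolds (metrics smooth on the slit tangent bundle, positively 1-homogeneous on fibres, with positive definite fundamental tensor) and $f:M_1\times M_2\to\mathbb{R}^+$ smooth. The twisted product $M_1\times_f M_2$ is $M=M_1\times M_2$ with $F=\sqrt{F_1^2(x,y)+f^2(x,u)F_2^2(u,v)}$, considered where $y\ne0$, $v\ne 0$. Local coordinates are $\mathbf{x}^a=(x^i,u^\alpha)$ with fibre coordinates $\mathbf{y}^a=(y^i,v^\alpha)$. Put $\mathbf g_{ab}=\frac12\frac{\partial^2F^2}{\partial\mathbf y^a\partial\mathbf y^b}$, spray coefficients $\mathbf G^a=\frac14\mathbf g^{ab}\big(\frac{\partial^2F^2}{\partial\mathbf y^b\partial\mathbf x^c}\mathbf y^c-\frac{\partial F^2}{\partial\mathbf x^b}\big)$, $\mathbf G^a_b=\frac{\partial\mathbf G^a}{\partial\mathbf y^b}$, $\frac{\delta^t}{\delta^t\mathbf x^a}=\frac{\partial}{\partial\mathbf x^a}-\mathbf G^b_a\frac{\partial}{\partial\mathbf y^b}$, and $$\mathbf F^c_{ab}=\tfrac12\mathbf g^{ce}\Big(\frac{\delta^t\mathbf g_{ea}}{\delta^t\mathbf x^b}+\frac{\delta^t\mathbf g_{eb}}{\delta^t\mathbf x^a}-\frac{\delta^t\mathbf g_{ab}}{\delta^t\mathbf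 x^e}\Big),\qquad \mathbf R^{\ a}_{b\ cd}=\frac{\delta^t\mathbf F^a_{bc}}{\delta^t\mathbf x^d}-\frac{\delta^t\mathbf F^a_{bd}}{\delta^t\mathbf x^c}+\mathbf F^a_{de}\mathbf F^e_{bc}-\mathbf F^a_{ce}\mathbf F^e_{bd}.$$ $(M_1\times_fM_2,F)$ is flat if $\mathbf R^{\ a}_{b\ cd}=0$. A Riemannian manifold is locally flat if its Riemann curvature tensor vanishes. ''$f$ is a function on $M_2$ only'' means $\partial f/\partial x^i=0$. *)

(* Defs.v *)
From HB Require Import structures.
From mathcomp Require Import all_boot all_order all_algebra.
From mathcomp Require Import all_classical all_reals all_analysis.

Set Implicit Arguments.
Unset Strict Implicit.
Unset Printing Implicit Defensive.

Import Order.TTheory GRing.Theory Num.Theory.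
Import numFieldNormedType.Exports.

Local Open Scope classical_set_scope.
Local Open Scope ring_scope.

Section Smooth.
Context {R : realType} {V W : normedModType R}.

(* C^k on an open set through directional derivatives; in finite dimension, the
   only case used below, this is the usual notion: taking v among the basis
   vectors gives existence and continuity of all iterated partials. *)
Fixpoint Ck_on (k : nat) (U : set V) (f : V -> W) : Prop :=
  (forall x, U x -> {for x, continuous f}) /\
  if k is k'.+1 then
    forall v, (forall x, U x -> derivable f x v) /\ Ck_on k' U ('D_v f)
  else True.

Definition smooth_on (U : set V) (f : V -> W) := forall k, Ck_on k U f.

End Smooth.

Section Manifold.
Context {R : realType}.

(* [cmap] and [cinv] are total functions, meaningful only on [cdom] and [cimg]. *)
Record chart (M : topologicalType) (n : nat) := Chart {
  cdom : set M;
  cimg : set 'rV[R]_n;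
  cmap : M -> 'rV[R]_n;
  cinv : 'rV[R]_n -> M;
  cdom_open : open cdom;
  cimg_open : open cimg;
  cmap_img : forall p, cdom p -> cimg (cmap p);
  cinv_dom : forall x, cimg x -> cdom (cinv x);
  cmapK : forall p, cdom p -> cinv (cmap p) = p;
  cinvK : forall x, cimg x -> cmap (cinv x) = x;
  cmap_continuous : {within cdom, continuous cmap};
  cinv_continuous : {within cimg, continuous cinv} }.

Section Transition.
Context {M : topologicalType} {n : nat}.
Implicit Types c d : chart M n.

Definition overlap c d : set 'rV[R]_n :=
  [set x | cimg c x /\ cdom d (cinv c x)].

Definition transition c d : 'rV[R]_n -> 'rV[R]_n :=
  fun x => cmap d (cinv c x).

End Transition.

Record manifold (n : nat) := Manifold {
  space :> topologicalType;
  space_hausdorff : hausdorff_space space;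
  space_second_countable : @second_countable space;
  space_nonempty : [set: space] !=set0;
  chart_index : Type;
  charts : chart_index -> chart space n;
  charts_cover : forall p : space, exists i, cdom (charts i) p;
  charts_compatible : forall i j,
    smooth_on (overlap (charts i) (charts j))
              (transition (charts i) (charts j)) }.

End Manifold.

Arguments chart R M n : clear implicits.
Arguments manifold R n : clear implicits.

(* The geometric objects of one coordinate domain of R^N, as functions of the
   position x and the fibre coordinate y. Derivatives and inverse matrices are
   the library's total operations. *)
Section LocalFinsler.
Context {R : realType} {N : nat}.
Implicit Types (H F : 'rV[R]_N -> 'rV[R]_N -> R) (a b c d : 'I_N)
  (x y : 'rV[R]_N).

Definition pdx a H x y : R := 'D_(delta_mx 0 a) (H^~ y) x.
Definition pdy a H x y : R := 'D_(delta_mx 0 a) (H x) y.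

Definition energy F x y : R := F x y ^+ 2.

Definition fund_tensor F x y : 'M[R]_N :=
  \matrix_(a, b) (2^-1 * pdy a (pdy b (energy F)) x y).

Definition spray F a x y : R :=
  4^-1 * \sum_b invmx (fund_tensor F x y) a b *
    ((\sum_c pdy b (pdx c (energy F)) x y * y 0 c) - pdx b (energy F) x y).

(* [nonlinear_conn F a b] is G^a_b. *)
Definition nonlinear_conn F a b : 'rV[R]_N -> 'rV[R]_N -> R :=
  pdy b (spray F a).

(* [hderiv F a] is delta / delta x^a. *)
Definition hderiv F a H x y : R :=
  pdx a H x y - \sum_b nonlinear_conn F b a x y * pdy b H x y.

Definition fund_coef F a b x y : R := fund_tensor F x y a b.

(* [hconn F c a b] is F^c_{ab}. *)
Definition hconn F c a b x y : R :=
  2^-1 * \sum_e invmx (fund_tensor F x y) c e *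
    (hderiv F b (fund_coef F e a) x y + hderiv F a (fund_coef F e b) x y
     - hderiv F e (fund_coef F a b) x y).

(* [hcurv F a b c d] is R_b^a_{cd}. *)
Definition hcurv F a b c d x y : R :=
  hderiv F d (hconn F a b c) x y - hderiv F c (hconn F a b d) x y
  + (\sum_e hconn F a d e x y * hconn F e b c x y)
  - (\sum_e hconn F a c e x y * hconn F e b d x y).

End LocalFinsler.

Section LocalRiemann.
Context {R : realType} {n : nat}.
Implicit Types (g : 'rV[R]_n -> 'M[R]_n) (i j k l : 'I_n) (x : 'rV[R]_n).

Definition bilin (A : 'M[R]_n) (y w : 'rV[R]_n) : R :=
  (y *m A *m w^T) 0 0.

Definition pd i (h : 'rV[R]_n -> R) x : R := 'D_(delta_mx 0 i) h x.

(* [christoffel g k i j] is Gamma^k_{ij}. *)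
Definition christoffel g k i j x : R :=
  2^-1 * \sum_l invmx (g x) k l *
    (pd j (fun z => g z l i) x + pd i (fun z => g z l j) x
     - pd l (fun z => g z i j) x).

(* [riemann_curv g i j k l] is R_j^i_{kl}, with the sign convention of [hcurv]. *)
Definition riemann_curv g i j k l x : R :=
  pd l (christoffel g i j k) x - pd k (christoffel g i j l) x
  + (\sum_m christoffel g i l m x * christoffel g m j k x)
  - (\sum_m christoffel g i k m x * christoffel g m j l x).

End LocalRiemann.

(* Functions on the tangent bundle and tensor fields are given by their
   expressions in the charts, subject to the transformation law: a tangent
   vector with coordinates y at x in chart i has coordinates 'D_y tau x in
   chart j, where tau is the transition map. *)
Section Structures.
Context {R : realType} {n : nat} (M : manifold R n).

Record finsler := Finsler {
  fnorm :> chart_index M -> 'rV[R]_n -> 'rV[R]_n -> R;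
  fnorm_compatible : forall i j x y,
    overlap (charts i) (charts j) x ->
    let tau := transition (charts i) (charts j) in
    fnorm j (tau x) ('D_y tau x) = fnorm i x y;
  fnorm_ge0 : forall i x y, cimg (charts i) x -> 0 <= fnorm i x y;
  fnorm_smooth : forall i,
    smooth_on [set p : 'rV[R]_n * 'rV[R]_n | cimg (charts i) p.1 /\ p.2 != 0]
              (fun p => fnorm i p.1 p.2);
  fnorm_homogeneous : forall i x y (t : R), cimg (charts i) x -> 0 < t ->
    fnorm i x (t *: y) = t * fnorm i x y;
  fnorm_posdef : forall i x y w, cimg (charts i) x -> y != 0 -> w != 0 ->
    0 < bilin (fund_tensor (fnorm i) x y) w w }.

Record riemannian_metric := RiemannianMetric {
  rmetric :> chart_index M -> 'rV[R]_n -> 'M[R]_n;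
  rmetric_compatible : forall i j x y w,
    overlap (charts i) (charts j) x ->
    let tau := transition (charts i) (charts j) in
    bilin (rmetric j (tau x)) ('D_y tau x) ('D_w tau x)
      = bilin (rmetric i x) y w;
  rmetric_smooth : forall i k l,
    smooth_on (cimg (charts i)) (fun x => rmetric i x k l);
  rmetric_sym : forall i x, cimg (charts i) x ->
    (rmetric i x)^T = rmetric i x;
  rmetric_posdef : forall i x w, cimg (charts i) x -> w != 0 ->
    0 < bilin (rmetric i x) w w }.

(* (M, F) is Riemannian, with metric tensor g. Such a g is determined by F on
   the coordinate domains, by polarization. *)
Definition is_riemannian (F : finsler) (g : riemannian_metric) :=
  forall i x y, cimg (charts i) x -> F i x y = Num.sqrt (bilin (g i x) y y).

Definition locally_flat (g : riemannian_metric) :=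
  forall i x, cimg (charts i) x ->
  forall a b c d, riemann_curv (g i) a b c d x = 0.

End Structures.

Section Twisted.
Context {R : realType} {n1 n2 : nat} {M1 : manifold R n1} {M2 : manifold R n2}.
Implicit Types (f : M1 * M2 -> R)
  (i : chart_index M1) (j : chart_index M2).

(* The expression f(x, u) of f in a product chart. *)
Definition local_expr f i j (x : 'rV[R]_n1) (u : 'rV[R]_n2) : R :=
  f (cinv (charts i) x, cinv (charts j) u).

Definition smooth_function f := forall i j,
  smooth_on [set p : 'rV[R]_n1 * 'rV[R]_n2 |
              cimg (charts i) p.1 /\ cimg (charts j) p.2]
            (fun p => local_expr f i j p.1 p.2).

(* [bx] and [by_] are (x, u) and (y, v) as vectors of R^(n1 + n2). *)
Definition twisted_norm (F1 : finsler M1) (F2 : finsler M2) f i j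
    (bx by_ : 'rV[R]_(n1 + n2)) : R :=
  let x := lsubmx bx in let u := rsubmx bx in
  let y := lsubmx by_ in let v := rsubmx by_ in
  Num.sqrt (F1 i x y ^+ 2 + local_expr f i j x u ^+ 2 * F2 j u v ^+ 2).

Definition flat_twisted_product (F1 : finsler M1) (F2 : finsler M2) f :=
  forall i j x u y v,
    cimg (charts i) x -> cimg (charts j) u -> y != 0 -> v != 0 ->
  forall a b c d,
    hcurv (twisted_norm F1 F2 f i j) a b c d (row_mx x u) (row_mx y v) = 0.

Definition depends_on_second_only f :=
  forall i j x u, cimg (charts i) x -> cimg (charts j) u ->
  forall k, pd k ((local_expr f i j)^~ u) x = 0.

End Twisted.

(* Main.v *)
Require Import Defs.
From mathcomp Require Import all_boot all_order all_algebra.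
From mathcomp Require Import all_classical all_reals all_analysis.
From mathcomp Require Import ring.

(** The fundamental tensor of a twisted product is block diagonal. When [F1] is
    Riemannian its upper block [g1 x] depends neither on [u] nor on the fibre
    coordinates, so the nonlinear connection drops out of the horizontal
    derivatives of that block: [F^i_{jk}] is the Christoffel symbol of [g1] and
    the mixed coefficients [F^i_{j alpha}] vanish. Hence the curvature
    components along [M1] are the Riemann curvature of [g1]. *)

Set Implicit Arguments.
Unset Strict Implicit.
Unset Printing Implicit Defensive.

Import Order.TTheory GRing.Theory Num.Theory.
Import numFieldNormedType.Exports.

Local Open Scope classical_set_scope.
Local Open Scope ring_scope.

Lemma open_near_fst (T U : topologicalType) (D : set (T * U)) x y :
  open D -> D (x, y) -> \forall z \near x, D (z, y).
Proof.
move=> D_open Dxy.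
have slice : (z, y) @[z --> x] --> (x, y).
  by apply: cvg_pair; [exact: cvg_id | exact: cvg_cst].
by apply: slice; exact: open_nbhs_nbhs.
Qed.

Lemma open_near_snd (T U : topologicalType) (D : set (T * U)) x y :
  open D -> D (x, y) -> \forall z \near y, D (x, z).
Proof.
move=> D_open Dxy.
have slice : (x, z) @[z --> y] --> (x, y).
  by apply: cvg_pair; [exact: cvg_cst | exact: cvg_id].
by apply: slice; exact: open_nbhs_nbhs.
Qed.

Lemma open_setX (T U : topologicalType) (A : set T) (B : set U) :
  open A -> open B -> open (A `*` B).
Proof.
move=> A_open B_open.
have -> : A `*` B = fst @^-1` A `&` snd @^-1` B by [].
apply: openI; apply: open_comp => // p _; [exact: cvg_fst | exact: cvg_snd].
Qed.

Lemma open_neq0 (R : numFieldType) (V : normedModType R) :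
  open [set v : V | v != 0].
Proof.
have -> : [set v : V | v != 0] = ~` [set 0].
  by apply/seteqP; split => v /= /eqP.
apply: closed_openC; apply: accessible_closed_set1.
exact/hausdorff_accessible/norm_hausdorff.
Qed.

Lemma open_split_rV (R : numFieldType) n1 n2 (A : set 'rV[R]_n1)
    (B : set 'rV[R]_n2) :
  open A -> open B -> open (lsubmx @^-1` A `&` rsubmx @^-1` B).
Proof.
move=> A_open B_open; apply: openI; apply: open_comp => // z _.
- exact: continuous_lsubmx.
- exact: continuous_rsubmx.
Qed.

Section DirectionalDerivative.
Context {R : numFieldType}.

Lemma eq_increment_derive (V V' W : normedModType R) (f : V -> W) (g : V' -> W)
    (x v : V) (x' v' : V') :
  (forall h : R, f (h *: v + x) - f x = g (h *: v' + x') - g x') ->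
  'D_v f x = 'D_v' g x'.
Proof. by move=> fg; rewrite /derive; under eq_fun do rewrite /= fg. Qed.

Lemma derive_comp_linear (V V' W : normedModType R) (L : {linear V -> V'})
    (f : V' -> W) (x v : V) :
  'D_v (f \o L) x = 'D_(L v) f (L x).
Proof. by apply: eq_increment_derive => h /=; rewrite linearD linearZ. Qed.

Lemma deriveD_constant_on_line (V W : normedModType R) (f g : V -> W)
    (x v : V) :
  (forall h, g (h *: v + x) = g x) -> 'D_v (f \+ g) x = 'D_v f x.
Proof.
move=> g_cst; apply: eq_increment_derive => h /=.
by rewrite g_cst opprD addrACA subrr addr0.
Qed.

(* No derivability is needed: where it fails, both sides are the default 0. *)
Lemma deriveZ_total (V : normedModType R) (f : V -> R) (k : R) (x v : V) :
  'D_v (k \*: f) x = k * 'D_v f x.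
Proof.
have [->|k_neq0] := eqVneq k 0.
  rewrite (_ : 0 \*: f = cst 0) ?derive_cst ?mul0r //.
  by apply/funext => z; exact: mul0r.
have [df|ndf] := pselect (derivable f x v); first exact: deriveZ.
have ndkf : ~ derivable (k \*: f) x v.
  move=> dkf; apply: ndf; rewrite (_ : f = k^-1 \*: (k \*: f)).
    exact: derivableZ.
  by apply/funext => z /=; rewrite scalerA mulVf ?scale1r.
by rewrite /derive (dvgP ndf) (dvgP ndkf) mulr0.
Qed.

Lemma derive_quadratic_on_line (V : normedModType R) (f : V -> R) (x v : V)
    (a b : R) :
  (forall h, f (h *: v + x) = f x + h * a + h ^+ 2 * b) -> 'D_v f x = a.
Proof.
move=> fE; apply: cvg_lim => //.
have slope : a + h * b @[h --> (0 : R)^'] --> a.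
  rewrite -[X in _ --> X]addr0 -[X in _ --> _ + X](mul0r b).
  apply: cvg_within_filter; apply: cvgD; first exact: cvg_cst.
  by apply: cvgM; [exact: cvg_id | exact: cvg_cst].
apply: cvg_trans slope; apply: near_eq_cvg; near=> h => /=.
have h_neq0 : h != 0 by near: h; exact: nbhs_dnbhs_neq.
have -> : f (h *: v + x) - f x = h * (a + h * b) by rewrite fE; ring.
exact/esym/mulKf.
Unshelve. all: by end_near. Qed.

End DirectionalDerivative.

Section PartialDerivativesOfBlocks.
Context {R : realType} {n1 n2 : nat}.
Implicit Types (h : 'rV[R]_n1 -> R) (k : 'rV[R]_n2 -> R) (z : 'rV[R]_(n1 + n2)).

Lemma pd_lsubmx_lshift h i z :
  pd (lshift n2 i) (h \o lsubmx) z = pd i h (lsubmx z).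
Proof. by rewrite /pd derive_comp_linear delta_mx_lshift /= row_mxKl. Qed.

Lemma pd_lsubmx_rshift h i z : pd (rshift n1 i) (h \o lsubmx) z = 0.
Proof.
by rewrite /pd derive_comp_linear delta_mx_rshift /= row_mxKl derive0.
Qed.

Lemma pd_rsubmx_lshift k i z : pd (lshift n2 i) (k \o rsubmx) z = 0.
Proof.
by rewrite /pd derive_comp_linear delta_mx_lshift /= row_mxKr derive0.
Qed.

Lemma pd_rsubmx_rshift k i z :
  pd (rshift n1 i) (k \o rsubmx) z = pd i k (rsubmx z).
Proof. by rewrite /pd derive_comp_linear delta_mx_rshift /= row_mxKr. Qed.

Lemma pd_split_lshift h k i :
  pd (lshift n2 i) ((h \o lsubmx) \+ (k \o rsubmx)) = pd i h \o lsubmx.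
Proof.
apply/funext => z; rewrite /= -pd_lsubmx_lshift.
apply: deriveD_constant_on_line => t /=.
by rewrite delta_mx_lshift linearD linearZ /= row_mxKr scaler0 add0r.
Qed.

Lemma pd_split_rshift h k i :
  pd (rshift n1 i) ((h \o lsubmx) \+ (k \o rsubmx)) = pd i k \o rsubmx.
Proof.
apply/funext => z; rewrite /= -pd_rsubmx_rshift /pd.
rewrite (_ : _ \+ _ = (k \o rsubmx) \+ (h \o lsubmx)); last first.
  by apply/funext => w /=; rewrite addrC.
apply: deriveD_constant_on_line => t /=.
by rewrite delta_mx_rshift linearD linearZ /= row_mxKl scaler0 add0r.
Qed.

End PartialDerivativesOfBlocks.

Section BilinearForm.
Context {R : realType} {n : nat}.
Implicit Types (A : 'M[R]_n) (y w : 'rV[R]_n).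

Lemma bilinDl A y y' w : bilin A (y + y') w = bilin A y w + bilin A y' w.
Proof. by rewrite /bilin !mulmxDl mxE. Qed.

Lemma bilinDr A y w w' : bilin A y (w + w') = bilin A y w + bilin A y w'.
Proof. by rewrite /bilin linearD mulmxDr mxE. Qed.

Lemma bilinZl A (t : R) y w : bilin A (t *: y) w = t * bilin A y w.
Proof. by rewrite /bilin -!scalemxAl mxE. Qed.

Lemma bilinZr A (t : R) y w : bilin A y (t *: w) = t * bilin A y w.
Proof. by rewrite /bilin linearZ -scalemxAr mxE. Qed.

Definition bilin_linE := (bilinDl, bilinDr, bilinZl, bilinZr).

Lemma bilin_delta A i j : bilin A (delta_mx 0 i) (delta_mx 0 j) = A i j.
Proof. by rewrite /bilin trmx_delta -rowE -colE !mxE. Qed.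

Section PositiveDefinite.
Variable A : 'M[R]_n.
Hypothesis A_posdef : forall w, w != 0 -> 0 < bilin A w w.

Lemma posdef_unitmx : A \in unitmx.
Proof.
rewrite -row_free_unit -kermx_eq0; apply/rowV0P => w /sub_kermxP wA.
apply/eqP; apply: contraT => /A_posdef.
by rewrite /bilin wA mul0mx mxE ltxx.
Qed.

Lemma posdef_bilin_ge0 y : 0 <= bilin A y y.
Proof.
have [->|/A_posdef/ltW//] := eqVneq y 0.
by rewrite /bilin !mul0mx mxE.
Qed.

End PositiveDefinite.

End BilinearForm.

Section Hessian.
Context {R : realType}.

Definition hessian n (K : 'rV[R]_n -> R) (y : 'rV[R]_n) : 'M[R]_n :=
  \matrix_(a, b) pd a (pd b K) y.

Lemma fund_tensorE n (F : 'rV[R]_n -> 'rV[R]_n -> R) x y :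
  fund_tensor F x y = 2^-1 *: hessian (energy F x) y.
Proof. by apply/matrixP => a b; rewrite !mxE. Qed.

Lemma hessianZ n (k : R) (K : 'rV[R]_n -> R) y :
  hessian (k \*: K) y = k *: hessian K y.
Proof.
have pdZ c (f : 'rV[R]_n -> R) : pd c (k \*: f) = k \*: pd c f.
  by apply/funext => z; rewrite /pd deriveZ_total.
by apply/matrixP => a b; rewrite !mxE !pdZ.
Qed.

Lemma hessian_bilin n (A : 'M[R]_n) y :
  hessian (fun z => bilin A z z) y = A + A^T.
Proof.
apply/matrixP => a b; rewrite !mxE.
have -> : pd b (fun z => bilin A z z) =
    fun z => bilin A (delta_mx 0 b) z + bilin A z (delta_mx 0 b).
  apply/funext => z; apply: (derive_quadratic_on_line (b := A b b)) => h.
  by rewrite !bilin_linE bilin_delta; ring.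
apply: (derive_quadratic_on_line (b := 0)) => h.
by rewrite !bilin_linE !bilin_delta; ring.
Qed.

Lemma hessian_split n1 n2 (K1 : 'rV[R]_n1 -> R) (K2 : 'rV[R]_n2 -> R) y :
  hessian ((K1 \o lsubmx) \+ (K2 \o rsubmx)) y =
  block_mx (hessian K1 (lsubmx y)) 0 0 (hessian K2 (rsubmx y)).
Proof.
apply/matrixP => a b; rewrite mxE.
case: (split_ordP a) => i ->; case: (split_ordP b) => j ->;
  rewrite ?(block_mxEul, block_mxEur, block_mxEdl, block_mxEdr) !mxE
          ?(pd_split_lshift, pd_split_rshift).
- exact: pd_lsubmx_lshift.
- exact: pd_rsubmx_lshift.
- exact: pd_lsubmx_rshift.
- exact: pd_rsubmx_rshift.
Qed.

End Hessian.

Lemma hderiv_fibre_constant (R : realType) (N : nat)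
    (F H : 'rV[R]_N -> 'rV[R]_N -> R) (h : 'rV[R]_N -> R)
    (D : set ('rV[R]_N * 'rV[R]_N)) x y a :
  open D -> (forall x' y', D (x', y') -> H x' y' = h x') -> D (x, y) ->
  hderiv F a H x y = pd a h x.
Proof.
move=> D_open Hh Dxy; rewrite /hderiv big1 ?subr0 => [|b _].
  apply: near_eq_derive; apply: filterS (open_near_fst D_open Dxy) => z.
  exact: Hh.
rewrite (_ : pdy b H x y = 0) ?mulr0 //.
rewrite -(derive_cst (h x) y (delta_mx 0 b)); apply: near_eq_derive.
by apply: filterS (open_near_snd D_open Dxy) => z; exact: Hh.
Qed.

Section BlockDiagonalFundTensor.
Context {R : realType} {n1 n2 : nat}.
Variable F : 'rV[R]_(n1 + n2) -> 'rV[R]_(n1 + n2) -> R.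
Variable D : set ('rV[R]_(n1 + n2) * 'rV[R]_(n1 + n2)).
Variable g : 'rV[R]_n1 -> 'M[R]_n1.
Variable g2 : 'rV[R]_(n1 + n2) -> 'rV[R]_(n1 + n2) -> 'M[R]_n2.

Hypothesis D_open : open D.
Hypothesis fund_tensor_block : forall x y, D (x, y) ->
  fund_tensor F x y = block_mx (g (lsubmx x)) 0 0 (g2 x y).
Hypothesis fund_tensor_unit : forall x y, D (x, y) ->
  fund_tensor F x y \in unitmx.

Section FunctionOfBase.
Variables (H : 'rV[R]_(n1 + n2) -> 'rV[R]_(n1 + n2) -> R) (h : 'rV[R]_n1 -> R).
Hypothesis H_base : forall x y, D (x, y) -> H x y = h (lsubmx x).

Lemma hderiv_base_lshift x y k : D (x, y) ->
  hderiv F (lshift n2 k) H x y = pd k h (lsubmx x).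
Proof.
move=> Dxy; rewrite -pd_lsubmx_lshift.
exact: hderiv_fibre_constant D_open H_base Dxy.
Qed.

Lemma hderiv_base_rshift x y k : D (x, y) -> hderiv F (rshift n1 k) H x y = 0.
Proof.
move=> Dxy; rewrite -(pd_lsubmx_rshift h k x).
exact: hderiv_fibre_constant D_open H_base Dxy.
Qed.

End FunctionOfBase.

Lemma hderiv_fund_coef_base_lshift x y i j k : D (x, y) ->
  hderiv F (lshift n2 k) (fund_coef F (lshift n2 i) (lshift n2 j)) x y =
  pd k (fun z => g z i j) (lsubmx x).
Proof.
apply: hderiv_base_lshift => x' y' D'.
by rewrite /fund_coef fund_tensor_block // block_mxEul.
Qed.

Lemma hderiv_fund_coef_base_rshift x y i j k : D (x, y) ->
  hderiv F (rshift n1 k) (fund_coef F (lshift n2 i) (lshift n2 j)) x y = 0.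
Proof.
apply: (hderiv_base_rshift (h := fun z => g z i j)) => x' y' D'.
by rewrite /fund_coef fund_tensor_block // block_mxEul.
Qed.

Lemma hderiv_fund_coef_mixed x y i j a : D (x, y) ->
  hderiv F a (fund_coef F (lshift n2 i) (rshift n1 j)) x y = 0.
Proof.
move=> Dxy; rewrite -(derive_cst (0 : R) x (delta_mx 0 a)).
apply: hderiv_fibre_constant Dxy => // x' y' D'.
by rewrite /fund_coef fund_tensor_block // block_mxEur mxE.
Qed.

Lemma hconn_lshift x y i a b : D (x, y) ->
  hconn F (lshift n2 i) a b x y =
  2^-1 * \sum_l invmx (g (lsubmx x)) i l *
    (hderiv F b (fund_coef F (lshift n2 l) a) x y
     + hderiv F a (fund_coef F (lshift n2 l) b) x y
     - hderiv F (lshift n2 l) (fund_coef F a b) x y).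
Proof.
move=> Dxy; rewrite /hconn fund_tensor_block // invmx_block_diag; last first.
  by rewrite -fund_tensor_block // fund_tensor_unit.
congr (_ * _); rewrite big_split_ord /= [X in _ + X]big1 ?addr0.
  by apply: eq_bigr => l _; rewrite block_mxEul.
by move=> l _; rewrite block_mxEur mxE mul0r.
Qed.

Lemma hconn_base x y i j k : D (x, y) ->
  hconn F (lshift n2 i) (lshift n2 j) (lshift n2 k) x y
  = christoffel g i j k (lsubmx x).
Proof.
move=> Dxy; rewrite hconn_lshift //; congr (_ * _); apply: eq_bigr => l _.
by rewrite !hderiv_fund_coef_base_lshift.
Qed.

Lemma hconn_mixed x y i j k : D (x, y) ->
  hconn F (lshift n2 i) (lshift n2 j) (rshift n1 k) x y = 0.
Proof.
move=> Dxy; rewrite hconn_lshift // big1 ?mulr0 // => l _.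
rewrite hderiv_fund_coef_base_rshift // !hderiv_fund_coef_mixed //.
by rewrite addr0 subr0 mulr0.
Qed.

Lemma hderiv_hconn_base x y i j k l : D (x, y) ->
  hderiv F (lshift n2 l) (hconn F (lshift n2 i) (lshift n2 j) (lshift n2 k)) x y
  = pd l (christoffel g i j k) (lsubmx x).
Proof. by apply: hderiv_base_lshift => x' y' D'; exact: hconn_base. Qed.

Lemma sum_hconn_base x y i j k l : D (x, y) ->
  \sum_e hconn F (lshift n2 i) (lshift n2 l) e x y
    * hconn F e (lshift n2 j) (lshift n2 k) x y
  = \sum_m christoffel g i l m (lsubmx x) * christoffel g m j k (lsubmx x).
Proof.
move=> Dxy; rewrite big_split_ord /= [X in _ + X]big1 ?addr0 => [|e _].
  by apply: eq_bigr => m _; rewrite !hconn_base.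
by rewrite hconn_mixed // mul0r.
Qed.

Lemma hcurv_base x y i j k l : D (x, y) ->
  hcurv F (lshift n2 i) (lshift n2 j) (lshift n2 k) (lshift n2 l) x y
  = riemann_curv g i j k l (lsubmx x).
Proof.
by move=> Dxy; rewrite /hcurv !hderiv_hconn_base // !sum_hconn_base.
Qed.

End BlockDiagonalFundTensor.

Lemma fund_tensor_unitmx (R : realType) n (M : manifold R n) (F : finsler M)
    i x y :
  cimg (charts i) x -> y != 0 -> fund_tensor (F i) x y \in unitmx.
Proof. by move=> ix y_neq0; apply: posdef_unitmx => w; exact: fnorm_posdef. Qed.

Lemma fund_tensor_riemannian (R : realType) n (M : manifold R n)
    (F : finsler M) (g : riemannian_metric M) i x y :
  is_riemannian F g -> cimg (charts i) x -> fund_tensor (F i) x y = g i x.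
Proof.
move=> Fg ix; have -> : fund_tensor (F i) x y =
    2^-1 *: hessian (fun z => bilin (g i x) z z) y.
  rewrite fund_tensorE; congr (_ *: hessian _ y); apply/funext => z.
  rewrite /energy Fg // sqr_sqrtr //; apply: posdef_bilin_ge0 => w.
  exact: rmetric_posdef.
rewrite hessian_bilin rmetric_sym //.
by apply/matrixP => a b; rewrite !mxE; field.
Qed.

Section TwistedProduct.
Context {R : realType} {n1 n2 : nat} {M1 : manifold R n1} {M2 : manifold R n2}.
Variables (F1 : finsler M1) (F2 : finsler M2) (f : M1 * M2 -> R).
Variables (i : chart_index M1) (j : chart_index M2).
Implicit Types x y : 'rV[R]_(n1 + n2).

Definition twisted_domain : set ('rV[R]_(n1 + n2) * 'rV[R]_(n1 + n2)) :=
  (lsubmx @^-1` cimg (charts i) `&` rsubmx @^-1` cimg (charts j)) `*`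
  (lsubmx @^-1` [set y | y != 0] `&` rsubmx @^-1` [set v | v != 0]).

Lemma open_twisted_domain : open twisted_domain.
Proof.
apply: open_setX; apply: open_split_rV.
- exact: cimg_open.
- exact: cimg_open.
- exact: open_neq0.
- exact: open_neq0.
Qed.

Lemma energy_twisted x :
  energy (twisted_norm F1 F2 f i j) x =
  (energy (F1 i) (lsubmx x) \o lsubmx) \+
  ((local_expr f i j (lsubmx x) (rsubmx x) ^+ 2 \*: energy (F2 j) (rsubmx x))
     \o rsubmx).
Proof.
apply/funext => y; rewrite /energy sqr_sqrtr //.
by rewrite addr_ge0 ?sqr_ge0 // mulr_ge0 ?sqr_ge0.
Qed.

Lemma fund_tensor_twisted x y :
  fund_tensor (twisted_norm F1 F2 f i j) x y =
  block_mx (fund_tensor (F1 i) (lsubmx x) (lsubmx y)) 0 0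
    (local_expr f i j (lsubmx x) (rsubmx x) ^+ 2 *:
       fund_tensor (F2 j) (rsubmx x) (rsubmx y)).
Proof.
rewrite !fund_tensorE energy_twisted hessian_split hessianZ.
by rewrite scale_block_mx !scaler0 !scalerA mulrC.
Qed.

Hypothesis f_neq0 : forall p, f p != 0.

Lemma fund_tensor_twisted_unitmx x y : twisted_domain (x, y) ->
  fund_tensor (twisted_norm F1 F2 f i j) x y \in unitmx.
Proof.
move=> [[ix jx] [y1_neq0 y2_neq0]].
rewrite fund_tensor_twisted block_diag_mx_unit.
by rewrite unitmxZ ?unitfE ?expf_neq0 ?f_neq0 ?fund_tensor_unitmx.
Qed.

Lemma hcurv_twisted_base (g : riemannian_metric M1) x y a b c d :
  is_riemannian F1 g -> twisted_domain (x, y) ->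
  hcurv (twisted_norm F1 F2 f i j)
    (lshift n2 a) (lshift n2 b) (lshift n2 c) (lshift n2 d) x y
  = riemann_curv (g i) a b c d (lsubmx x).
Proof.
move=> F1g; apply: hcurv_base => {x y} [|x y [[ix _] _]|x y].
- exact: open_twisted_domain.
- by rewrite fund_tensor_twisted (fund_tensor_riemannian _ F1g).
- exact: fund_tensor_twisted_unitmx.
Qed.

End TwistedProduct.

Theorem theorem3 (R : realType) (n1 n2 : nat) (hn1 : (0 < n1)%N) (hn2 : (0 < n2)%N)
  (M1 : manifold R n1) (M2 : manifold R n2)
  (F1 : finsler M1) (F2 : finsler M2)
  (f : M1 * M2 -> R) (f_gt0 : forall p, 0 < f p) (f_smooth : smooth_function f)
  (F_flat : flat_twisted_product F1 F2 f)
  (g1 : riemannian_metric M1) (F1_riemannian : is_riemannian F1 g1)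
  (f_M2 : depends_on_second_only f) :
  locally_flat g1.
Proof.
move=> i x ix a b c d.
have [p _] := space_nonempty M2; have [j jp] := charts_cover p.
pose u := cmap (charts j) p; have ju : cimg (charts j) u := cmap_img jp.
have ones_neq0 n : (0 < n)%N -> const_mx 1 != 0 :> 'rV[R]_n.
  move=> n_gt0; apply/eqP => /rowP/(_ (Ordinal n_gt0))/eqP.
  by rewrite !mxE oner_eq0.
have f_neq0 q : f q != 0 by rewrite gt_eqF.
have Dxu :
    twisted_domain i j (row_mx x u, row_mx (const_mx 1) (const_mx 1)).
  by do 2!split; rewrite /= ?row_mxKl ?row_mxKr ?ones_neq0.
have := hcurv_twisted_base F2 f_neq0 a b c d F1_riemannian Dxu.
by rewrite row_mxKl => <-; apply: F_flat; rewrite ?ones_neq0.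
Qed.
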